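(* Let $(X,p,E)$ and $(E,m,F)$ be two $p$-KB-spaces (i.e. $(X,p,E)$ is a $p$-KB-space with lattice norm $p$, and $(E,m,F)$ is a $p$-KB-space with lattice norm $m$). Then the lattice-normed vector lattice $(X,m\circ p,F)$ is also a $p$-KB-space (with respect to the lattice norm $m\circ p$).
   Context: All vector lattices are real and Archimedean. A net $(x_\alpha)$ in a vector lattice is order convergent to $x$ ($x_\alpha\xrightarrow{o}x$) if there is a net $(y_\beta)$ (possibly with a different index set) with $y_\beta\downarrow 0$ such that for each $\beta$ there is $\alpha_\beta$ with $|x_\alpha-x|\le y_\beta$ for all $\alpha\ge\alpha_\beta$. A lattice-normed vector lattice (LNVL) is a triple $(X,p,E)$, where $X$ and $E$ are vector lattices and the lattice norm $p:X\to E_+$ satisfies: $p(x)=0\Leftrightarrow x=0$; $p(\lambda x)=|\lambda|p(x)$; $p(x+y)\le p(x)+p(y)$; and $|x|\le|y|\Rightarrow p(x)\le p(y)$. A net $x_\alpha$ $p$-converges to $x$ if $p(x_\alpha-x)\xrightarrow{o}0$ in $E$. A subset $A\subseteq X$ is $p$-bounded if there is $e\in E$ with $p(a)\le e$ for all $a\in A$. An LNVL $(X,p,E)$ is a $p$-KB-space if every $p$-bounded increasing net in $X_+$ is $p$-convergent in $X$. *)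

(* Defs.v *)
From HB Require Import structures.
From mathcomp Require Import all_boot all_order all_algebra.
From mathcomp Require Import classical_sets reals.

Set Implicit Arguments.
Unset Strict Implicit.
Unset Printing Implicit Defensive.
Import Order.TTheory GRing.Theory Num.Theory.
Local Open Scope classical_set_scope.
Local Open Scope ring_scope.

(* An ordered vector space in which any two elements have a supremum and an
   infimum. Order.Lattice is not reused because Hierarchy-Builder rejects any
   structure over both it and Zmodule that is declared after Num.RealDomain. *)
HB.mixin Record POrderedLmodule_isVectorLattice (R : realType) V
    of GRing.Lmodule R V & Num.POrderedZmodule V := {
  vlat_leD2r : forall z x y : V, x <= y -> x + z <= y + z;
  vlat_leZ2l : forall (a : R) (x y : V), 0 <= a -> x <= y -> a *: x <= a *: y;
  vjoin : V -> V -> V;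
  vmeet : V -> V -> V;
  leUv : forall x y z : V, (vjoin x y <= z) = (x <= z) && (y <= z);
  levI : forall x y z : V, (z <= vmeet x y) = (z <= x) && (z <= y)
}.

#[short(type="vectorLatticeType")]
HB.structure Definition VectorLattice (R : realType) :=
  { V of GRing.Lmodule R V & Num.POrderedZmodule V
       & POrderedLmodule_isVectorLattice R V }.

HB.mixin Record VectorLattice_isArchimedean (R : realType) V
    of VectorLattice R V := {
  vlat_archimedean : forall x y : V, (forall n : nat, x *+ n <= y) -> x <= 0
}.

#[short(type="archiVectorLatticeType")]
HB.structure Definition ArchiVectorLattice (R : realType) :=
  { V of VectorLattice R V & VectorLattice_isArchimedean R V }.

Definition vabs (R : realType) (V : vectorLatticeType R) (x : V) : V :=
  vjoin x (- x).

(* Index sets of nets: nonempty directed preorders. *)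
Record directedSet := DirectedSet {
  dir_sort :> Type;
  dir_le : dir_sort -> dir_sort -> Prop;
  dir_inh : inhabited dir_sort;
  dir_refl : forall i, dir_le i i;
  dir_trans : forall i j k, dir_le i j -> dir_le j k -> dir_le i k;
  dir_ub : forall i j, exists k, dir_le i k /\ dir_le j k
}.

Section VectorLatticeNets.
Variables (R : realType) (V : vectorLatticeType R) (I : directedSet).
Implicit Type x : I -> V.

Definition increasing_net x := forall i j, dir_le i j -> x i <= x j.

Definition decreasing_net x := forall i j, dir_le i j -> x j <= x i.

Definition decreases_to0 x :=
  [/\ decreasing_net x,
      forall i, 0 <= x i
    & forall z, (forall i, z <= x i) -> z <= 0].

End VectorLatticeNets.

Definition order_cvg (R : realType) (V : vectorLatticeType R)
    (I : directedSet) (x : I -> V) (l : V) :=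
  exists (J : directedSet) (y : J -> V), decreases_to0 y /\
    forall j, exists i0, forall i, dir_le i0 i -> vabs (x i - l) <= y j.

Section LatticeNormed.
Variables (R : realType) (X E : vectorLatticeType R) (p : X -> E).

Definition lattice_norm :=
  [/\ forall x, 0 <= p x,
      forall x, p x = 0 <-> x = 0,
      forall (a : R) x, p (a *: x) = `|a| *: p x,
      forall x y, p (x + y) <= p x + p y
    & forall x y, vabs x <= vabs y -> p x <= p y].

Definition p_cvg (I : directedSet) (x : I -> X) (l : X) :=
  order_cvg (fun i => p (x i - l)) 0.

Definition p_bounded (A : set X) := exists e : E, forall a, A a -> p a <= e.

Definition pKB_space :=
  lattice_norm /\
  forall (I : directedSet) (x : I -> X),
    (forall i, 0 <= x i) -> increasing_net x -> p_bounded (range x) ->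
    exists l : X, p_cvg x l.

End LatticeNormed.

(* Main.v *)
Require Import Defs.
From mathcomp Require Import all_boot all_order all_algebra.
From mathcomp Require Import classical_sets reals.

(** A lattice-norm limit of an increasing net is its least upper bound. So
    if [x] is increasing and [m \o p]-bounded, then [p \o x] has an [m]-limit
    and is bounded in [E] by it; hence [x] has a [p]-limit [l]. The increasing
    net [p l - p (l - x i)] in [E] is [m]-bounded by [m (p l)] and has least
    upper bound [p l]; so [p l] is its [m]-limit, which says that
    [m (p (x i - l))] is order convergent to 0. *)

Set Implicit Arguments.
Unset Strict Implicit.
Unset Printing Implicit Defensive.
Import Order.TTheory GRing.Theory Num.Theory.
Local Open Scope ring_scope.

Section VectorLatticeTheory.
Variables (R : realType) (V : vectorLatticeType R).
Implicit Types x y z : V.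

Lemma vlat_subr_ge0 x y : (0 <= y - x) = (x <= y).
Proof.
apply/idP/idP => [/(vlat_leD2r x)|/(vlat_leD2r (- x))].
  by rewrite add0r subrK.
by rewrite subrr.
Qed.

Lemma vlat_lerBlDr x y z : (x - y <= z) = (x <= z + y).
Proof. by rewrite -(vlat_subr_ge0 x) -(vlat_subr_ge0 (x - y)) opprB addrA. Qed.

Lemma vlat_lerBlDl x y z : (x - y <= z) = (x <= y + z).
Proof. by rewrite vlat_lerBlDr addrC. Qed.

Lemma vlat_lerB2l x y z : y <= z -> x - z <= x - y.
Proof.
move=> leyz; rewrite -vlat_subr_ge0 opprB addrC addrA subrK.
by rewrite vlat_subr_ge0.
Qed.

Lemma vjoin_ub x y : x <= vjoin x y /\ y <= vjoin x y.
Proof. by apply/andP; rewrite -leUv. Qed.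

Lemma vjoin_le x y z : x <= z -> y <= z -> vjoin x y <= z.
Proof. by move=> xz yz; rewrite leUv xz. Qed.

(** Adding [x <= vabs x] and [- x <= vabs x] gives [0 <= vabs x + vabs x], which is then halved. *)
Lemma vabs_ge0 x : 0 <= vabs x.
Proof.
have [xle Nxle] := vjoin_ub x (- x).
have h : 0 <= vabs x + vabs x.
  rewrite -[leLHS](addrN x); apply: le_trans (vlat_leD2r (- x) _ _ xle) _.
  by rewrite addrC; exact: vlat_leD2r.
have : 0 <= 2^-1 *: (vabs x + vabs x).
  by rewrite -(scaler0 V 2^-1); apply: vlat_leZ2l; rewrite // invr_ge0 ler0n.
by rewrite -mulr2n -scaler_nat scalerA mulVf ?pnatr_eq0// scale1r.
Qed.

Lemma ger0_vabs x : 0 <= x -> vabs x = x.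
Proof.
move=> x0; apply: le_anti; apply/andP; split.
  apply: vjoin_le => //; apply: (le_trans _ x0).
  by rewrite -vlat_subr_ge0 sub0r opprK.
by have [] := vjoin_ub x (- x).
Qed.

Lemma vjoin0_le_vabs x : vjoin x 0 <= vabs x.
Proof. by apply: vjoin_le (vabs_ge0 x); have [] := vjoin_ub x (- x). Qed.

End VectorLatticeTheory.

Section LatticeNormTheory.
Variables (R : realType) (X E : vectorLatticeType R) (p : X -> E).
Hypothesis pnorm : lattice_norm p.

Lemma lattice_norm_ge0 x : 0 <= p x.
Proof. by case: pnorm. Qed.

Lemma lattice_norm_mono x y : 0 <= x -> x <= y -> p x <= p y.
Proof.
move=> x0 xy; have y0 := le_trans x0 xy.
by case: pnorm => _ _ _ _; apply; rewrite !ger0_vabs.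
Qed.

Lemma lattice_normN x : p (- x) = p x.
Proof.
by case: pnorm => _ _ pZ _ _; rewrite -scaleN1r pZ normrN1 scale1r.
Qed.

Lemma lattice_normB x y : p (x - y) = p (y - x).
Proof. by rewrite -lattice_normN opprB. Qed.

Lemma lattice_norm_pos_part x : p (vjoin x 0) <= p x.
Proof.
case: pnorm => _ _ _ _; apply.
by rewrite ger0_vabs ?vjoin0_le_vabs//; have [] := vjoin_ub x 0.
Qed.

(** Each member of the net decreasing to 0 dominates [p (x k - l)] for some [k] beyond [i], by
    directedness, so [z] is a lower bound of that net. Requiring the bound only on a tail lets
    monotonicity of [x] be used beyond [i]. *)
Lemma p_cvg_inf0 (I : directedSet) (x : I -> X) (l : X) (z : E) (i : I) :
  p_cvg p x l -> (forall j, dir_le i j -> z <= p (x j - l)) -> z <= 0.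
Proof.
move=> [J [y [[_ _ yinf] yx]]] zle; apply: yinf => j.
have [i0 xy] := yx j; have [k [i0k ik]] := dir_ub i0 i.
apply: le_trans (zle k ik) _.
by have := xy k i0k; rewrite subr0 ger0_vabs// lattice_norm_ge0.
Qed.

(** Reduces an inequality in [X] to a norm estimate in [E]: the positive part of [u - v] has norm 0,
    hence vanishes. *)
Lemma pos_part_le0 (u v : X) : p (vjoin (u - v) 0) <= 0 -> u <= v.
Proof.
move=> ple0; have /eqP : p (vjoin (u - v) 0) == 0.
  by rewrite eq_le ple0 lattice_norm_ge0.
case: pnorm => _ p0 _ _ _ /p0 uv0.
have [] := vjoin_ub (u - v) 0.
by rewrite uv0 vlat_lerBlDr add0r.
Qed.

Lemma lattice_norm_vjoin0_mono (u v : X) : u <= v -> p (vjoin u 0) <= p v.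
Proof.
move=> uv; apply: le_trans (lattice_norm_pos_part v).
have [vle v0] := vjoin_ub v 0; have [_ u0] := vjoin_ub u 0.
by apply: lattice_norm_mono u0 _; apply: vjoin_le v0; apply: le_trans vle.
Qed.

Lemma p_cvg_increasing_ub (I : directedSet) (x : I -> X) (l : X) :
  increasing_net x -> p_cvg p x l -> forall i, x i <= l.
Proof.
(* For [j] beyond [i], [x i - l <= x j - l], so the norm of the positive part of [x i - l] is at
   most [p (x j - l)]. *)
move=> xinc xl i; apply: pos_part_le0; apply: (p_cvg_inf0 (i := i) xl) => j ij.
by apply: lattice_norm_vjoin0_mono; apply: vlat_leD2r; exact: xinc.
Qed.

Lemma p_cvg_le (I : directedSet) (x : I -> X) (l u : X) :
  p_cvg p x l -> (forall i, x i <= u) -> l <= u.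
Proof.
move=> xl xu; have [i] := dir_inh I.
(* Here [l - u <= l - x j] for every [j], so any starting index will do. *)
apply: pos_part_le0; apply: (p_cvg_inf0 (i := i) xl) => j _.
by rewrite lattice_normB; apply: lattice_norm_vjoin0_mono; exact: vlat_lerB2l.
Qed.

End LatticeNormTheory.

Lemma lattice_norm_comp (R : realType) (X E F : vectorLatticeType R)
    (p : X -> E) (m : E -> F) :
  lattice_norm p -> lattice_norm m -> lattice_norm (m \o p).
Proof.
move=> pn mn; have p_ge0 := lattice_norm_ge0 pn.
case: (pn) => _ p0 pZ pD pM; case: (mn) => _ m0 mZ mD _.
split=> /= [x|x|a x|x y|x y xy].
- exact: lattice_norm_ge0.
- by split=> [/m0/p0|/p0/m0].
- by rewrite pZ mZ normr_id.
- exact: le_trans (lattice_norm_mono mn (p_ge0 _) (pD x y)) (mD _ _).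
- exact: lattice_norm_mono (p_ge0 _) (pM _ _ xy).
Qed.

Theorem theorem5p2 (R : realType) (X E F : archiVectorLatticeType R)
    (p : X -> E) (m : E -> F) :
  pKB_space p -> pKB_space m -> pKB_space (m \o p).
Proof.
move=> [pn pKB] [mn mKB]; split; first exact: lattice_norm_comp.
move=> I x x0 xinc [f xf]; have p_ge0 := lattice_norm_ge0 pn.
have pxinc : increasing_net (p \o x).
  by move=> i j ij; apply: lattice_norm_mono (x0 i) (xinc i j ij).
have [||e pxe] := mKB I (p \o x) _ pxinc; first by move=> i; exact: p_ge0.
  by exists f => _ [i _ <-]; apply: xf; exists i.
have [|l xl] := pKB I x x0 xinc.
  by exists e => _ [i _ <-]; exact: (p_cvg_increasing_ub mn pxinc pxe i).
exists l; have x_le := p_cvg_increasing_ub pn xinc xl.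
(* The net [p (l - x i)] is decreasing; subtracting it from [p l] yields a positive increasing net,
   to which [mKB] applies. *)
pose z i := p l - p (l - x i).
have z_ge0 i : 0 <= z i.
  rewrite vlat_subr_ge0; apply: (lattice_norm_mono pn).
    by rewrite vlat_subr_ge0.
  by rewrite vlat_lerBlDl -vlat_lerBlDr subrr.
have z_le i : z i <= p l by rewrite vlat_lerBlDl -vlat_lerBlDr subrr.
have zinc : increasing_net z.
  move=> i j ij; apply: vlat_lerB2l; apply: (lattice_norm_mono pn).
    by rewrite vlat_subr_ge0.
  by apply: vlat_lerB2l; exact: xinc.
have [|l' zl'] := mKB I z z_ge0 zinc.
  by exists (m (p l)) => _ [i _ <-]; exact: lattice_norm_mono (z_ge0 i) (z_le i).
have l'E : l' = p l.
  apply: le_anti; rewrite (p_cvg_le mn zl' z_le) /=.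
  have [i0] := dir_inh I.
  (* Since [z i <= l'], the element [p l - l'] is a lower bound of all [p (l - x i)], and these have
     infimum 0. *)
  have : p l - l' <= 0.
    apply: (p_cvg_inf0 pn (i := i0) xl) => i _; rewrite (lattice_normB pn).
    rewrite vlat_lerBlDr -vlat_lerBlDl.
    exact: (p_cvg_increasing_ub mn zinc zl' i).
  by rewrite vlat_lerBlDr add0r.
(* As [z i - p l = - p (l - x i)], the net dominating [m (z i - l')] also dominates
   [m (p (x i - l))]. *)
have [J [y [y0 yz]]] := zl'; exists J, y; split=> // j.
have [i0 iy] := yz j; exists i0 => i /iy.
by rewrite l'E /z addrAC subrr add0r (lattice_normN mn) /= (lattice_normB pn).
Qed.
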